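(* Let $1\leq p<\infty$ and $q>1$, and let $f:[0,1]\to\mathcal{L}^p(\Omega)\cap\mathcal{W}^{1,q}(\Omega)$, $t\mapsto f_t$, be a mapping which is continuous with respect to the topology induced by $\|\cdot\|_p$. Then there is an open dense set $T\subset[0,1]$ such that for all $t\in T$ and any sequence $(t_n)_{n\in\mathbb{N}}$ in $[0,1]$ with limit $t$, $$\lim_{n\to\infty}f_{t_n}(x)=f_t(x)\quad\text{for all }x\in\Omega.$$
   Context: $\Omega=[0,1]$ with its Borel $\sigma$-field and Lebesgue measure. $\mathcal{L}^p(\Omega)$ is the space of real-valued $p$-integrable functions on $\Omega$, where almost everywhere equal functions are NOT identified, equipped with the topology induced by the seminorm $\|\cdot\|_p$. $\mathcal{W}^{1,q}(\Omega)$ is the space of all absolutely continuous functions on $\Omega$ with derivative belonging to $\mathcal{L}^q(\Omega)$. *)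

(* Defs.v *)
From HB Require Import structures.
From mathcomp Require Import all_boot all_order all_algebra.
From mathcomp Require Import all_classical all_reals all_analysis.

Set Implicit Arguments.
Unset Strict Implicit.
Unset Printing Implicit Defensive.
Import Order.TTheory GRing.Theory Num.Theory.
Import numFieldNormedType.Exports.
Local Open Scope classical_set_scope.
Local Open Scope ring_scope.

(* Functions on the unit interval are represented by total functions on R,
   of which only the values on Omega are ever used. *)
Definition Omega (R : realType) : set R := `[0, 1]%classic.
Arguments Omega : clear implicits.

(* Extension by zero turns Borel functions, integrals and essential suprema of
   absolute values over Omega into the corresponding notions over R. *)
Definition Lfun_Omega (R : realType) (p : \bar R) : set (R -> R) :=
  [set g | g \_ (Omega R) \in Lfun (@lebesgue_measure R) p].

Definition Lnorm_Omega (R : realType) (p : \bar R) (g : R -> R) : \bar R :=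
  'N[@lebesgue_measure R]_p[EFin \o (g \_ (Omega R))]%E.

(* Neighbourhood filter of g in the topology induced by the seminorm. *)
Definition Lnbhs_Omega (R : realType) (p : \bar R) (g : R -> R) :
    set_system (R -> R) :=
  filter_from [set e : R | 0 < e]
    (fun e => [set h | (Lnorm_Omega p (h \- g)%R < e%:E)%E]).

Definition absolutely_continuous (R : realType) (a b : R) (g : R -> R) : Prop :=
  forall e : R, 0 < e -> exists2 d : R, 0 < d &
    forall (n : nat) (u v : 'I_n -> R),
      (forall i, [&& a <= u i, u i <= v i & v i <= b]) ->
      trivIset setT (fun i => `]u i, v i[%classic) ->
      \sum_(i < n) (v i - u i) < d ->
      \sum_(i < n) `|g (v i) - g (u i)| < e.

(* The derivative of an absolutely continuous function exists almost
   everywhere only; g' in L^q means that some h in L^q represents it. The open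
   interval keeps values of g outside Omega out of the derivative. *)
Definition W1_Omega (R : realType) (q : \bar R) : set (R -> R) :=
  [set g | absolutely_continuous 0 1 g /\
    exists2 h : R -> R, Lfun_Omega q h &
      {ae @lebesgue_measure R,
        forall x : R, x \in `]0, 1[%R -> is_derive x 1 g (h x)}].

(* Main.v *)
Require Import Defs.
From HB Require Import structures.
From mathcomp Require Import all_boot all_order all_algebra.
From mathcomp Require Import all_classical all_reals all_analysis.
From mathcomp Require Import measurable_realfun ess_sup_inf lra.

Set Implicit Arguments.
Unset Strict Implicit.
Unset Printing Implicit Defensive.
Import Order.TTheory GRing.Theory Num.Theory.
Import numFieldNormedType.Exports.
Local Open Scope classical_set_scope.
Local Open Scope ring_scope.

(** The exponent q > 1 enters only through Hölder continuity: if g is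
absolutely continuous with g' in L^q, then
|g y - g x| <= ||g'||_q |y - x|^a with a = 1 - 1/q > 0 ([W1_Omega_hoelder];
for infinite q the exponent 2 is used in its place).
So every f_t lies in one of countably many uniformly equicontinuous classes,
those of the functions that are a-Hölder with constant n.

Inside such a class the seminorm ||.||_p controls uniform convergence: if
|D x| >= e and D is Hölder with constant K, then |D| >= e/2 on an interval
whose length depends only on K, a and e, which bounds ||D||_p from below
([hoelder_Lnorm_small]). Applied to D = f_s - f_t, this shows that f_s -> f_t
uniformly when s -> t and s stays in
A_n = {s | f_s is a-Hölder with constant n} ([hoelder_uniform_near]). Hence
A_n is closed, and at the interior points of A_n the convergence asked for
holds. The A_n cover [0, 1], so by Baire's theorem the union T of their
interiors is dense ([Baire_closed_cover]).

For the Hölder bound it suffices to compare g with H x, the integral of |h| up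
to x, where h represents g': almost everywhere g and H are both differentiable
and |g'| <= H', hence |g b - g a| <= H b - H a ([ac_increment_le]), and
Hölder's inequality bounds the right-hand side. The comparison is a covering
argument. Near a point where both derivatives exist, increments of g are
controlled by those of H up to a small multiple of the length; the other
points form a null set, contained in an open set of small measure, over which
g varies little by absolute continuity. A finite chain of such small intervals
joins a to b by compactness ([straddle_induction]). *)

(** * Induction along an interval and linear approximation *)

(** A form of Cousin's covering lemma. The step moves P from s to y across a
point x of [s, y], which is the shape of an estimate by a derivative at x. The
proof applies the step at the supremum of the points where P holds, which the
step would exceed if it were less than b. *)
Lemma straddle_induction (R : realType) (a b : R) (P : R -> Prop) :
    a <= b -> P a ->
    (forall x, a <= x <= b -> exists2 r : R, 0 < r &
      forall s y, a <= s <= x -> x <= y <= b -> x - r < s -> y < x + r ->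
        P s -> P y) ->
  P b.
Proof.
move=> ab Pa step.
pose S := [set x | a <= x <= b /\ P x].
have Sa : S a by split => //; rewrite lexx.
have ubS : ubound S b by move=> x [/andP[]].
have supS : has_sup S by split; [exists a | exists b].
have cab : a <= sup S <= b.
  by rewrite ub_le_sup//=; [exact: ge_sup (ex_intro _ a Sa) ubS| exists b].
have [r r0 st] := step _ cab.
have [s [/andP[as_ sb] Ps] crs] := sup_adherent r0 supS.
have sc : s <= sup S.
  by apply: ub_le_sup; [exists b | split => //; rewrite as_].
pose y := Num.min b (sup S + r / 2).
have cy : sup S <= y.
  by rewrite le_min (andP cab).2 lerDl divr_ge0// ltW.
have Py : P y.
  apply: (st s) => //.
  by rewrite as_.
  by rewrite cy ge_min lexx.
  by rewrite gt_min ltrD2l gtr_pMr// invf_lt1// ltr1n orbT.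
have yc : y <= sup S.
  apply: ub_le_sup; first by exists b.
  by split => //; rewrite (le_trans (andP cab).1 cy)/= ge_min lexx.
suff <- : y = b by [].
move: yc; rewrite /y minEle; case: ifPn => // _.
by rewrite leNgt ltrDl divr_gt0.
Qed.

(** Linear approximation without a quotient, so that estimates on the two sides
of x can be added, the base point y = x included. *)
Lemma is_derive_near (R : realType) (g : R -> R) (x l e : R) :
    is_derive x 1 g l -> 0 < e -> exists2 r : R, 0 < r &
  forall y, `|y - x| < r -> `|g y - g x - l * (y - x)| <= e * `|y - x|.
Proof.
move=> [dg gl] e0.
have /cvgrPdist_lt /(_ _ e0) : h^-1 *: (g (h + x) - g x) @[h --> 0^'] --> l.
  rewrite -gl; move: (dg : cvg _); rewrite /derive.
  have -> : (fun h : R => h^-1 *: ((g \o shift x) (h *: 1) - g x)) =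
      (fun h => h^-1 *: (g (h + x) - g x)).
    by apply/funext => h /=; rewrite /shift/= [_ *: 1]mulr1.
  exact.
move=> /nbhs_ballP[r /= r0 H]; exists r => // y yx.
have [->|yNx] := eqVneq y x; first by rewrite !subrr !mulr0 subr0 normr0 mulr0.
have d0 : y - x != 0 by rewrite subr_eq0.
have := H (y - x); rewrite -ball_normE /= sub0r normrN => /(_ yx d0).
rewrite subrK => /ltW; rewrite -(ler_pM2r (_ : 0 < `|y - x|)) ?normr_gt0//.
rewrite -normrM mulrBl.
suff -> : (y - x)^-1 *: (g y - g x) * (y - x) = g y - g x.
  by rewrite distrC.
by rewrite /GRing.scale/= mulrAC mulVf// mul1r.
Qed.

(** * Increments of absolutely continuous functions *)

(** Outer regularity, applied to a measurable null set containing N. *)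
Lemma null_set_open_cover (R : realType) (N : set R) (d : R) :
    (@lebesgue_measure R).-negligible N -> 0 < d ->
  exists U : set R, [/\ open U, N `<=` U & (lebesgue_measure U < d%:E)%E].
Proof.
move=> [B [mB B0 NB]] d0.
have [|U [oU BU UB]] := lebesgue_regularity_outer mB _ d0.
  by rewrite [ltLHS](B0 : _ = 0%E) ltry.
exists U; split => //; first exact: subset_trans BU.
rewrite -(setDUK BU) measureU//; last 2 first.
- by apply: measurableD => //; exact: open_measurable.
- exact: setDIK.
by rewrite [X in (X + _)%E](B0 : _ = 0%E) add0e.
Qed.

Lemma disjoint_itv_sum_le (R : realType) (U : set R) (n : nat)
    (u v : 'I_n -> R) :
    measurable U -> (forall i, u i <= v i) ->
    (forall i, `]u i, v i[ `<=` U) ->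
    trivIset setT (fun i => `]u i, v i[%classic) ->
  ((\sum_(i < n) (v i - u i))%:E <= lebesgue_measure U)%E.
Proof.
move=> mU uv UU tI.
have -> : ((\sum_(i < n) (v i - u i))%:E =
    \sum_(i < n) lebesgue_measure `]u i, v i[%classic)%E.
  rewrite -sumEFin; apply: eq_bigr => i _.
  rewrite lebesgue_measure_itv/= lte_fin; case: ltgtP (uv i) => // ->.
  by rewrite subrr.
rewrite -measure_bigsetU_ord//; apply: le_measure => //; rewrite ?inE//.
  exact: bigsetU_measurable.
by rewrite -bigcup_seq => x [i _]; exact: UU.
Qed.

(** Split at x: on [s, x] and on [x, y] the linear approximations of g and of H
at x are compared using |l| <= m, and each of the two functions contributes an
error of e/2 per unit of length. *)
Lemma straddle_increment_le (R : realType) (g H : R -> R) (x l m e : R) :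
    is_derive x 1 g l -> is_derive x 1 H m -> `|l| <= m -> 0 < e ->
  exists2 r : R, 0 < r & forall s y, s <= x <= y -> x - r < s -> y < x + r ->
    `|g y - g s| <= H y - H s + e * (y - s).
Proof.
move=> dg dH lm e0; have e20 : 0 < e / 2 by rewrite divr_gt0.
have [r1 r10 Hg] := is_derive_near dg e20.
have [r2 r20 HH] := is_derive_near dH e20.
exists (Num.min r1 r2); first by rewrite lt_min r10.
move=> s y /andP[sx xy] rs yr.
have near z : `|z - x| < Num.min r1 r2 ->
    `|g z - g x| <= m * `|z - x| + e / 2 * `|z - x| /\
    `|H z - H x - m * (z - x)| <= e / 2 * `|z - x|.
  rewrite lt_min => /andP[/Hg zg /HH zH]; split => //.
  rewrite -[g z - g x](subrK (l * (z - x))) (le_trans (ler_normD _ _))// addrC.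
  by rewrite lerD// normrM ler_wpM2r.
have [] := near y; first by rewrite ger0_norm ?subr_ge0// ltrBlDl.
have [] := near s.
  by rewrite ler0_norm ?subr_le0// opprB ltrBlDl -ltrBlDr.
rewrite (ler0_norm (_ : s - x <= 0)) ?subr_le0//.
rewrite (ger0_norm (_ : 0 <= y - x)) ?subr_ge0//.
move=> gs; rewrite ler_norml => /andP[_ Hs] gy.
rewrite ler_norml => /andP[Hy _].
rewrite (le_trans (ler_distD (g x) _ _))// (distrC (g x)).
by lra.
Qed.

Lemma ordered_itv_trivIset (R : realType) (n : nat) (u v : 'I_n -> R) :
    (forall i j : 'I_n, (i < j)%N -> v i <= u j) ->
  trivIset setT (fun i => `]u i, v i[%classic).
Proof.
move=> vu i j _ _ [x [/=]]; rewrite !in_itv/= => /andP[ix xi] /andP[jx xj].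
apply: val_inj; case: (ltngtP i j) => // /vu.
- by rewrite leNgt (lt_trans jx).
- by rewrite leNgt (lt_trans ix).
Qed.

(** A mean value inequality in which a null set of exceptional points is
allowed. Were g not absolutely continuous it would fail for the Cantor
function with H = 0. The proof runs along [a, b] and records the straddling
intervals that were crossed at exceptional points: they are disjoint and lie
in an open set of measure less than d, so their total contribution to the
variation of g is small. *)
Lemma ac_increment_le (R : realType) (a b : R) (g H : R -> R) :
    a <= b -> absolutely_continuous a b g ->
    {in `[a, b] &, {homo H : x y / x <= y}} ->
    {ae @lebesgue_measure R, forall x, x \in `]a, b[ ->
      exists l m, [/\ is_derive x 1 g l, is_derive x 1 H m & `|l| <= m]} ->
  `|g b - g a| <= H b - H a.
Proof.
move=> ab acg ndH dgH; apply/ler_addgt0Pr => e' e'0.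
pose e := e' / (1 + (b - a)).
have ba0 : 0 < 1 + (b - a) by rewrite ltr_pwDl// subr_ge0.
have e0 : 0 < e by rewrite divr_gt0.
have -> : e' = e + e * (b - a) by rewrite -{1}[e]mulr1 -mulrDr /e divfK ?gt_eqF.
have [d d0 acd] := acg e e0.
pose good x := x \in `]a, b[ ->
  exists l m, [/\ is_derive x 1 g l, is_derive x 1 H m & `|l| <= m].
pose N := ~` [set x | good x] `|` ([set a] `|` [set b]).
have N0 : (@lebesgue_measure R).-negligible N.
  apply: negligibleU; first exact: dgH.
  by apply: negligibleU; apply/negligibleP => //; exact: lebesgue_measure_set1.
have [U [oU NU Ud]] := null_set_open_cover N0 d0.
have mU : measurable U := open_measurable oU.
(* The intervals [u i, v i] are those crossed at exceptional points; keeping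
   them in increasing order makes them disjoint. *)
pose P x := exists n (u v : nat -> R),
  [/\ forall i, (i < n)%N -> [/\ a <= u i, u i <= v i & v i <= x],
      forall i, (i < n)%N -> `]u i, v i[ `<=` U,
      forall i j, (i < j < n)%N -> v i <= u j &
      `|g x - g a| <=
        \sum_(i < n) `|g (v i) - g (u i)| + (H x - H a) + e * (x - a)].
have [n [u [v [uv UU vu]]]] : P b.
  apply: (straddle_induction ab).
    exists 0%N, (fun=> 0), (fun=> 0); split => //.
    by rewrite !subrr big_ord0 normr0 mulr0 !addr0.
  move=> x /andP[ax xb].
  (* At a point of U the interval [s, y] itself is recorded, since it can be
     chosen inside U; elsewhere the list is left unchanged. *)
  have [Ux|Ux] := pselect (U x).
    have [r /= r0 rU] : nbhs_ball x U.
      by apply/nbhs_ballP; exact: open_nbhs_nbhs.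
    exists r => // s y /andP[as_ sx] /andP[xy yb] rs yr.
    move=> [n [u [v [uv UU vu gs]]]].
    exists n.+1, (fun i => if i == n then s else u i),
      (fun i => if i == n then y else v i); split.
    - move=> i; rewrite ltnS leq_eqVlt; case: eqP => [_ _|_ /= /uv[? ? vs]].
        by split => //; exact: le_trans xy.
      by split => //; apply: le_trans vs (le_trans sx xy).
    - move=> i; rewrite ltnS leq_eqVlt; case: eqP => [_ _|_ /= /UU//].
      move=> z /=; rewrite in_itv/= => /andP[sz zy]; apply: rU.
      by rewrite -ball_normE/= ltr_distlC (lt_trans rs)//= (lt_trans zy).
    - move=> i j /andP[ij]; rewrite ltnS leq_eqVlt.
      case: (eqVneq j n) => [jn _|jn /= jn'].
        have iltn : (i < n)%N by rewrite -jn.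
        by rewrite (ltn_eqF iltn); have [] := uv _ iltn.
      by rewrite (ltn_eqF (ltn_trans ij jn')); apply: vu; rewrite ij.
    - rewrite big_ord_recr/= eqxx.
      under eq_bigr => i _ do rewrite (ltn_eqF (ltn_ord i)).
      rewrite (le_trans (ler_distD (g s) _ _))//.
      have Hsy : H s <= H y.
        apply: ndH; rewrite ?in_itv/= ?as_ ?yb ?andbT/=.
        - exact: le_trans sx xb.
        - exact: le_trans ax xy.
        - exact: le_trans sx xy.
      have : e * (s - a) <= e * (y - a).
        by rewrite ler_pM2l// lerD2r (le_trans sx).
      by lra.
  have NNx : ~ N x by move=> /NU.
  have gx : good x by apply: contrapT => ?; apply: NNx; left.
  have xa : a < x.
    by rewrite lt_neqAle ax andbT; apply/eqP => ?; apply: NNx; right; left.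
  have xb' : x < b.
    by rewrite lt_neqAle xb andbT; apply/eqP => ?; apply: NNx; right; right.
  have [|l [m [dg dH lm]]] := gx; first by rewrite in_itv/= xa.
  have [r r0 Hr] := straddle_increment_le dg dH lm e0.
  exists r => // s y /andP[as_ sx] /andP[xy yb] rs yr.
  move=> [n [u [v [uv UU vu gs]]]]; exists n, u, v; split => //.
    move=> i /uv[? ? vs]; split => //.
    exact: le_trans vs (le_trans sx xy).
  rewrite (le_trans (ler_distD (g s) _ _))//.
  have := Hr s y; rewrite sx xy => /(_ erefl rs yr).
  by lra.
suff : \sum_(i < n) `|g (v i) - g (u i)| < e by lra.
apply: (acd n (fun i => u i) (fun i => v i)).
- by move=> i; have [-> -> ->] := uv i (ltn_ord i).
- by apply: ordered_itv_trivIset => i j ij; rewrite vu// ij/=.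
- rewrite -lte_fin (le_lt_trans _ Ud)//; apply: disjoint_itv_sum_le => //.
  + by move=> i; have [] := uv i (ltn_ord i).
  + by move=> i; apply: UU.
  + by apply: ordered_itv_trivIset => i j ij; rewrite vu// ij/=.
Qed.

(** * Hölder's inequality on a set and comparison of exponents *)

(** Hölder's inequality for g and the indicator of A. *)
Lemma integral_norm_le_Lnorm d (T : measurableType d) (R : realType)
    (mu : {measure set T -> \bar R}) (A : set T) (g : T -> R) (r : R) :
    measurable A -> measurable_fun setT g -> 1 < r ->
  (\int[mu]_(x in A) `|g x|%:E <=
    'N[mu]_r%:E[EFin \o g] * mu A `^ (1 - r^-1))%E.
Proof.
move=> mA mg r1.
have r0 : 0 < r by exact: lt_trans r1.
have s0 : 0 < 1 - r^-1 by rewrite subr_gt0 invf_lt1.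
have mA1 : measurable_fun setT (\1_A : T -> R) by exact: measurable_indic.
have := @hoelder _ _ _ mu g (\1_A) r (1 - r^-1)^-1 mg mA1 r0.
rewrite invr_gt0 invrK => /(_ s0); rewrite addrC subrK => /(_ erefl).
rewrite Lnorm1 => Hh; apply: le_trans (le_trans Hh _).
  rewrite integral_mkcond le_eqVlt; apply/orP; left; apply/eqP.
  apply: eq_integral => x _; rewrite patchE/= indicE.
  by case: ifPn => _; rewrite ?mulr1 ?mulr0 ?normr0.
rewrite lee_wpmul2l ?Lnorm_ge0// unlock invrK.
have <- : (\int[mu]_x (\1_A x)%:E = mu A)%E by rewrite integral_indic// setIT.
rewrite le_eqVlt; apply/orP; left; apply/eqP; congr (_ `^ _)%E.
apply: eq_integral => x _ /=; rewrite indicE.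
case: (x \in A) => /=; first by rewrite normr1 powR1.
by rewrite normr0 powR0// gt_eqF// invr_gt0.
Qed.

Lemma lebesgue_measure_Omega (R : realType) :
  lebesgue_measure (Omega R) = 1%E.
Proof.
by rewrite /Omega lebesgue_measure_itv/= lte_fin ltr01 sube0.
Qed.

(** An infinite exponent can be replaced by 2, as Omega has finite measure; the
same r serves all functions, so the Hölder exponent will depend on q only. *)
Lemma Lfun_Omega_finite_exponent (R : realType) (q : \bar R) : (1%:E < q)%E ->
  exists2 r : R, 1 < r & forall h, Lfun_Omega q h -> Lfun_Omega r%:E h.
Proof.
case: q => [r r1| _|//]; first by exists r.
exists 2; first by rewrite ltr1n.
rewrite /Lfun_Omega => h /=; set h0 := h \_ _.
rewrite !inE => /andP[/[!inE]/= mh].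
rewrite /finite_norm unlock => hoo.
apply/andP; split; rewrite inE//= /finite_norm unlock poweR_lty//.
have mO : measurable (Omega R) by exact: measurable_itv.
have lT : (0 < @lebesgue_measure R setT)%E.
  apply: (@lt_le_trans _ _ (lebesgue_measure (Omega R))); last first.
    by apply: le_measure; rewrite ?inE.
  by rewrite lebesgue_measure_Omega lte_fin.
move: hoo; rewrite lT => /ess_supr_bounded[M hM].
apply: (@le_lt_trans _ _ (\int[lebesgue_measure]_(x in Omega R) (M `^ 2)%:E)%E).
  rewrite [leRHS]integral_mkcond; apply: ae_ge0_le_integral => //.
  - by move=> x _; rewrite lee_fin powR_ge0.
  - apply/measurable_EFinP.
    apply: (@measurableT_comp _ _ _ _ _ _ (@powR R ^~ 2)) => //.
    exact: measurableT_comp.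
  - by move=> x _; rewrite patchE; case: ifP => // _; rewrite lee_fin powR_ge0.
  - apply/(measurable_restrictT _ mO); exact: measurable_cst.
  - apply: filterS hM => x /= hxM _.
    rewrite patchE; move: hxM; rewrite /h0 patchE; case: ifP => _ hxM.
      by rewrite lee_fin ge0_ler_powR// nnegrE// (le_trans _ hxM).
    by rewrite normr0 powR0.
rewrite integral_cst// [X in (_ * X)%E](lebesgue_measure_Omega R).
by rewrite -EFinM ltry.
Qed.

(** * Hölder continuity of Sobolev functions *)

Definition hoelder_Omega (R : realType) (a C : R) (g : R -> R) :=
  forall x y, Omega R x -> Omega R y -> `|g x - g y| <= C * `|x - y| `^ a.

Lemma Lfun_Omega_integrable (R : realType) (r : R) (h : R -> R) :
    1 < r -> Lfun_Omega r%:E h ->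
  lebesgue_measure.-integrable setT (EFin \o (h \_ (Omega R))).
Proof.
move=> r1; rewrite /Lfun_Omega/= inE => /andP[/[!inE]/= mh hoo].
have mO : measurable (Omega R) by exact: measurable_itv.
apply/integrableP; split; first exact/measurable_EFinP.
have -> : (\int[lebesgue_measure]_x `|(EFin \o h \_ (Omega R)) x| =
    \int[lebesgue_measure]_(x in Omega R) `|(h \_ (Omega R)) x|%:E)%E.
  rewrite [RHS]integral_mkcond; apply: eq_integral => x _ /=.
  by rewrite !patchE; case: ifPn => xO; rewrite ?xO// normr0.
have le := @integral_norm_le_Lnorm _ _ R lebesgue_measure _ _ _ mO mh r1.
apply: (le_lt_trans le).
rewrite lte_mul_pinfty ?Lnorm_ge0 ?ge0_fin_numE ?Lnorm_ge0//.
by rewrite poweR_lty// [ltLHS](lebesgue_measure_Omega R) ltry.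
Qed.

(** Morrey's inequality in dimension one. The comparison function H is the
primitive of |h|, whose derivative is |h| almost everywhere by Lebesgue's
differentiation theorem. *)
Lemma W1_Omega_hoelder (R : realType) (q : \bar R) : (1%:E < q)%E ->
  exists2 a : R, 0 < a &
    forall g, W1_Omega q g -> exists C : R, hoelder_Omega a C g.
Proof.
move=> /Lfun_Omega_finite_exponent[r r1 qr].
exists (1 - r^-1).
  by rewrite subr_gt0 invf_lt1 ?(lt_trans ltr01).
move=> g [acg [h /qr hr dg]].
set mu := @lebesgue_measure R.
pose k x := `|(h \_ (Omega R)) x|.
have ik : mu.-integrable setT (EFin \o k).
  have /integrable_norm := Lfun_Omega_integrable r1 hr.
  exact: eq_integrable.
pose H x := \int[mu]_(t in `]-oo, x]) k t.
have dH : {ae mu, forall x, derivable H x 1 /\ derive1 H x = k x}.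
  apply: FTC1Ny.
    by move=> y; apply: integrableS ik.
  by apply: open_integrable_locally => //; exact: openT.
move: (hr); rewrite /Lfun_Omega/= inE => /andP[/[!inE]/= mh].
rewrite /finite_norm -/mu => hoo.
set c := 'N[mu]_(r%:E)[(EFin \o h \_ (Omega R))]%E in hoo.
exists (fine c) => x y.
wlog xy : x y / x <= y => [W Ox Oy|].
  have [/W|/ltW/W] := leP x y; first exact.
  by rewrite distrC (distrC x); exact.
rewrite /Omega/= !in_itv/= => /andP[x0 _] /andP[_ y1].
rewrite distrC (distrC x) (ger0_norm (_ : 0 <= y - x)) ?subr_ge0//.
have HB s t : s <= t -> H t - H s = \int[mu]_(z in `]s, t]) k z.
  by move=> st; rewrite /H Rintegral_itvB//; apply: integrableS ik.
apply: (@le_trans _ _ (H y - H x)).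
  apply: ac_increment_le => //.
  - move=> e /acg[d d0 D]; exists d => // n u v uv; apply: D => i.
    have /and3P[xu -> vy] := uv i.
    by rewrite (le_trans x0 xu) (le_trans vy y1).
  - move=> s t _ _ st; rewrite -subr_ge0 HB//.
    by apply: Rintegral_ge0 => z _; rewrite /k/= normr_ge0.
  - apply: (filterS2 (ae_filter_ringOfSetsType mu) _ dg dH).
    move=> z gz [Hz Hz'] zxy.
    have z01 : z \in `]0, 1[.
      move: zxy; rewrite !in_itv/= => /andP[xz zy].
      by rewrite (le_lt_trans x0 xz) (lt_le_trans zy y1).
    exists (h z), (k z); split; first exact: gz.
      by rewrite -Hz' derive1E; exact: derivableP.
    rewrite /k/= patchE mem_set//= /Omega/=; apply: subset_itv_oo_cc.
    exact: z01.
rewrite HB// -lee_fin /Rintegral fineK; last first.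
  by apply: integrable_fin_num => //; apply: integrableS ik.
have mxy : measurable `]x, y]%classic by exact: measurable_itv.
apply: (le_trans (@integral_norm_le_Lnorm _ _ R mu _ _ _ mxy mh r1)).
rewrite -/c EFinM fineK ?ge0_fin_numE ?Lnorm_ge0//.
have lxy : mu `]x, y]%classic = (y - x)%:E.
  rewrite /mu lebesgue_measure_itv/= lte_fin.
  by move: xy; rewrite le_eqVlt => /predU1P[->|->//]; rewrite ltxx subrr.
by rewrite lee_wpmul2l ?Lnorm_ge0// [X in (X `^ _)%E](lxy).
Qed.

(** * Equi-Hölder functions with small seminorm are uniformly small *)

(** Markov's inequality, for a set that contains an interval. *)
Lemma Lnorm_ge_itv (R : realType) (p : R) (D : R -> R) (u v e : R) :
    1 <= p -> measurable_fun setT (D \_ (Omega R)) -> u <= v -> 0 <= e ->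
    (forall y, y \in `[u, v] -> Omega R y /\ e <= `|D y|) ->
  ((e * (v - u) `^ p^-1)%:E <= Lnorm_Omega p%:E D)%E.
Proof.
move=> p1 mD uv e0 De.
have p0 : 0 < p by exact: lt_le_trans p1.
have mJ : measurable `[u, v]%classic by exact: measurable_itv.
set mu := @lebesgue_measure R.
have lJ : mu `[u, v]%classic = (v - u)%:E.
  rewrite /mu lebesgue_measure_itv/= lte_fin.
  by move: uv; rewrite le_eqVlt => /predU1P[->|->//]; rewrite ltxx subrr.
have -> : ((e * (v - u) `^ p^-1)%:E =
    ((e `^ p)%:E * mu `[u, v]%classic) `^ p^-1)%E.
  rewrite [X in (_ * X)%E]lJ -EFinM poweR_EFin powRM ?powR_ge0 ?subr_ge0//.
  by rewrite -powRrM divff ?gt_eqF// powRr1.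
rewrite /Lnorm_Omega unlock; apply: gt0_ler_poweR.
- by rewrite invr_ge0 ltW.
- by rewrite in_itv/= leey andbT mule_ge0// lee_fin powR_ge0.
- by rewrite in_itv/= leey andbT integral_ge0// => x _;
    rewrite lee_fin powR_ge0.
rewrite -integral_cst// [leLHS]integral_mkcond; apply: ge0_le_integral => //.
- by move=> x _; rewrite patchE; case: ifP => // _; rewrite lee_fin powR_ge0.
- by apply/(measurable_restrictT _ mJ); exact: measurable_cst.
- apply/measurable_EFinP.
  apply: (@measurableT_comp _ _ _ _ _ _ (@powR R ^~ p)) => //.
  exact: measurableT_comp.
- move=> x _; rewrite patchE; case: ifPn => [/set_mem xJ|_]; last first.
    by rewrite lee_fin powR_ge0.
  have [Ox ex] := De _ xJ; rewrite lee_fin patchE mem_set//.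
  by rewrite ge0_ler_powR// ?nnegrE// ltW.
Qed.

(** The bound d must not depend on D: this is what makes convergence in
seminorm uniform over a whole Hölder class. *)
Lemma hoelder_Lnorm_small (R : realType) (p a K e : R) :
    1 <= p -> 0 < a -> 0 < e ->
  exists2 d : R, 0 < d & forall D : R -> R,
    measurable_fun setT (D \_ (Omega R)) -> hoelder_Omega a K D ->
    (Lnorm_Omega p%:E D < d%:E)%E -> forall x, Omega R x -> `|D x| < e.
Proof.
move=> p1 a0 e0.
(* No sign is assumed for K, and the division below needs a positive
   constant. *)
pose K' := Num.max K 1.
have K'0 : 0 < K' by rewrite lt_max ltr01 orbT.
(* c is a length over which D moves by at most e/2; with c <= 1/2 there is an
   interval of length c that contains x and stays inside Omega. *)
pose c := Num.min 2^-1 ((e / 2 / K') `^ a^-1).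
have c0 : 0 < c.
  by rewrite lt_min invr_gt0 ltr0n/= powR_gt0// !divr_gt0.
exists (e / 2 * c `^ p^-1).
  by rewrite mulr_gt0 ?powR_gt0 ?divr_gt0.
move=> D mD hD; rewrite ltNge => Dd x Ox; rewrite ltNge; apply: contra Dd => eD.
have [u [uO vO xu uv]] : exists u, [/\ 0 <= u, u + c <= 1, u <= x & x <= u + c].
  move: (Ox); rewrite /Omega/= in_itv/= => /andP[x0 x1].
  have c2 : c <= 2^-1 by rewrite ge_min lexx.
  have c2' : 2 * c <= 1 by rewrite mulrC -ler_pdivlMr ?div1r.
  by have [x2|x2] := leP (x + c) 1; [exists x | exists (x - c)]; split; lra.
have -> : c = u + c - u by lra.
apply: Lnorm_ge_itv => //.
- by rewrite lerDl ltW.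
- by rewrite divr_ge0 // ltW.
move=> y; rewrite in_itv/= => /andP[uy yv].
have Oy : Omega R y by rewrite /Omega/= in_itv/= (le_trans uO)// (le_trans yv).
split => //.
have : `|D x - D y| <= e / 2.
  apply: (le_trans (hD x y Ox Oy)).
  apply: (@le_trans _ _ (K' * `|x - y| `^ a)).
    by rewrite ler_wpM2r ?powR_ge0// le_max lexx.
  have xyc : `|x - y| <= c by rewrite ler_norml; apply/andP; split; lra.
  rewrite mulrC -ler_pdivlMr//.
  apply: (@le_trans _ _ (c `^ a)).
    by rewrite ge0_ler_powR// ?nnegrE// ltW.
  apply: (@le_trans _ _ (((e / 2 / K') `^ a^-1) `^ a)).
    apply: ge0_ler_powR; rewrite ?nnegrE ?powR_ge0//; [exact: ltW..|].
    by rewrite ge_min lexx orbT.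
  by rewrite -powRrM mulVf ?gt_eqF// powRr1// !divr_ge0// ltW.
have := ler_normD (D x - D y) (D y); rewrite subrK.
by lra.
Qed.

(** * Baire category and the theorem *)

(** The set O_n, the complement of the boundary part of A_n, is open and dense;
a point of V lying in every O_n belongs to some A_n, hence to its interior. *)
Lemma Baire_closed_cover (R : realType) (U : completeNormedModType R)
    (A : nat -> set U) (V : set U) :
    (forall n, closed (A n)) -> open V -> V `<=` \bigcup_n A n ->
  V `<=` closure (\bigcup_n (A n)^°).
Proof.
move=> cA oV VA x Vx B Bx.
pose O n := ~` A n `|` (A n)^°.
have : dense (\bigcap_n O n).
  apply: Baire => n; split.
    by apply: openU; [exact: closed_openC|exact: open_interior].
  move=> W [w Ww] oW.
  have [WA|] := pselect (W `<=` A n).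
    exists w; split => //; right.
    by apply: (interiorS WA); rewrite /interior; exact: open_nbhs_nbhs.
  by move=> /nonsubset[z [Wz Az]]; exists z; split => //; left.
have BVx : nbhs x (B `&` V) by apply: filterI => //; exact: open_nbhs_nbhs.
move=> /(_ (B `&` V)^° _ (open_interior _))[|z [zBV zO]]; first by exists x.
have [Bz /VA[n _ Anz]] := interior_subset zBV.
exists z; split => //; exists n => //.
by have [|] := zO n I.
Qed.

Lemma Omega_closure (R : realType) :
  Omega R `<=` closure (`]0, 1[%classic : set R).
Proof.
move=> x; rewrite /Omega/= in_itv/= => /andP[x0 x1] B.
move=> /nbhs_ballP[r /= r0 rB].
pose s := Num.min (r / 2) 2^-1.
have s0 : 0 < s by rewrite lt_min divr_gt0//= invr_gt0 ltr0n.
have sr : s < r by rewrite gt_min gtr_pMr// invf_lt1// ltr1n.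
have s2 : 2 * s <= 1.
  by rewrite mulrC -ler_pdivlMr// div1r ge_min lexx orbT.
have [x2|x2] := leP x 2^-1.
  exists (x + s / 2); split.
    by rewrite /= in_itv/=; apply/andP; split; lra.
  by apply: rB; rewrite -ball_normE/= opprD addNKr normrN ger0_norm; lra.
exists (x - s / 2); split.
  by rewrite /= in_itv/=; apply/andP; split; lra.
by apply: rB; rewrite -ball_normE/= opprB addrC subrK ger0_norm; lra.
Qed.

(** f_s - f_t is Hölder with a constant n + C that is the same for all the s in
question, where C is a Hölder constant of f_t alone. This serves both for the
closedness of the classes, where t need not be known to be n-Hölder, and for
the convergence at their interior points. *)
Lemma hoelder_uniform_near (R : realType) (p a : R) (f : R -> R -> R) (t : R)
    (n : nat) (e : R) :
    1 <= p -> 0 < a -> 0 < e ->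
    (forall s, Omega R s -> Lfun_Omega p%:E (f s)) ->
    f s @[s --> within (Omega R) (nbhs t)] --> Lnbhs_Omega p%:E (f t) ->
    Omega R t -> (exists C, hoelder_Omega a C (f t)) ->
  \forall s \near t, Omega R s -> hoelder_Omega a n%:R (f s) ->
    forall x, Omega R x -> `|f s x - f t x| < e.
Proof.
move=> p1 a0 e0 fL ft Ot [C hC].
have mf s : Omega R s -> measurable_fun setT (f s \_ (Omega R)).
  by move=> /fL; rewrite /Lfun_Omega/= inE => /andP[/[!inE]].
have [d d0 small] := hoelder_Lnorm_small (n%:R + C) p1 a0 e0.
have : \forall s \near within (Omega R) (nbhs t),
    (Lnorm_Omega p%:E (f s \- f t)%R < d%:E)%E.
  suff /ft : Lnbhs_Omega p%:E (f t)
    [set h | (Lnorm_Omega p%:E (h \- f t)%R < d%:E)%E] by [].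
  by exists d.
rewrite near_withinE; apply: filterS => s ds Os hs x Ox.
apply: (small (f s \- f t)) => //; last exact: ds.
  rewrite (_ : _ \_ _ = (f s \_ (Omega R)) \- (f t \_ (Omega R))).
    by apply: measurable_funB; exact: mf.
  by apply/funext => z /=; rewrite !patchE; case: ifP => //; rewrite subrr.
move=> y z Oy Oz /=; rewrite mulrDl.
have := hs _ _ Oy Oz; have := hC _ _ Oy Oz.
have := ler_normB (f s y - f s z) (f t y - f t z).
rewrite (_ : f s y - f s z - (f t y - f t z) =
  f s y - f t y - (f s z - f t z)); last by lra.
by lra.
Qed.

Theorem proposition3p2 (R : realType) (p : R) (q : \bar R)
    (p1 : 1 <= p) (q1 : (1%:E < q)%E) (f : R -> R -> R)
    (f_mem : forall t, Omega R t -> (Lfun_Omega p%:E `&` W1_Omega q) (f t))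
    (f_cont : forall t, Omega R t ->
      f s @[s --> within (Omega R) (nbhs t)] --> Lnbhs_Omega p%:E (f t)) :
  exists T : set R,
    [/\ T `<=` Omega R,
        open (T : set (subspace (Omega R))),
        Omega R `<=` closure T &
        forall t, T t ->
        forall t_ : nat -> R, (forall n, Omega R (t_ n)) ->
          t_ n @[n --> \oo] --> t ->
          forall x, Omega R x -> f (t_ n) x @[n --> \oo] --> f t x].
Proof.
have [a a0 W1h] := W1_Omega_hoelder q1.
have fh t : Omega R t -> exists C, hoelder_Omega a C (f t).
  by move=> /f_mem[_]; exact: W1h.
have fL t : Omega R t -> Lfun_Omega p%:E (f t) by move=> /f_mem[].
have unear t n e : Omega R t -> 0 < e -> _ := fun Ot e0 =>
  hoelder_uniform_near n p1 a0 e0 fL (f_cont t Ot) Ot (fh t Ot).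
pose A n := [set t | Omega R t /\ hoelder_Omega a n%:R (f t)].
have cO : closed (Omega R) by exact: interval_closed.
have cA n : closed (A n).
  move=> t clt.
  have Ot : Omega R t by apply: cO; apply: closureS clt => s [].
  split => // x y Ox Oy; apply/ler_addgt0Pr => e e0.
  have e20 : 0 < e / 2 by rewrite divr_gt0.
  have [s [[Os hs] /(_ Os hs) fst]] := clt _ (unear t n _ Ot e20).
  have := fst _ Ox; have := fst _ Oy; have := hs _ _ Ox Oy.
  have := ler_distD (f s x) (f t x) (f t y).
  have := ler_distD (f s y) (f s x) (f t y).
  rewrite (distrC (f t x) (f s x)); lra.
have AO : `]0, 1[%classic `<=` \bigcup_n A n.
  move=> t t01; have Ot : Omega R t by apply: subset_itv_oo_cc.
  have [C hC] := fh t Ot.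
  (* Any natural number above the Hölder constant of f_t will do. *)
  exists (Num.truncn C).+1 => //; split => // x y Ox Oy.
  apply: (le_trans (hC x y Ox Oy)).
  by rewrite ler_wpM2r ?powR_ge0// ltW// truncnS_gt.
exists (\bigcup_n (A n)^°); split.
- by move=> t [n _ /interior_subset[]].
- apply: open_subspaceW; apply: bigcup_open => n _; exact: open_interior.
- apply: subset_trans (@Omega_closure R) _.
  apply: subset_trans (@closed_closure _ _).
  by apply: closureS; apply: Baire_closed_cover AO => //; exact: interval_open.
- move=> t [n _ At] t_ t_O t_t x Ox.
  have [Ot _] := interior_subset At.
  apply/cvgrPdist_lt => e e0.
  near=> k.
  have [Ok hk] : A n (t_ k) by near: k; exact: (t_t _ At).
  rewrite distrC; move: x Ox.
  apply: (_ : Omega R _ -> hoelder_Omega _ _ _ -> _) Ok hk.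
  by near: k; exact: (t_t _ (unear t n e Ot e0)).
Unshelve. all: by end_near. Qed.
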